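(* In the class of all graphs, connectivity of nodes is expressible in the modal language of graph theory: there is a formula $\chi(x,y)$ in $\Diamond\mathcal{L}_\sim$ such that for every graph $G$ and all vertices $x,y$ of $G$, $$G\models\chi(x,y)\quad\text{if and only if}\quad x\text{ is connected to }y\text{ in }G.$$ Similarly, there is a sentence in $\mathcal{L}_\sim^{\Diamond}$ that holds in a graph $G$ if and only if $G$ as a whole is connected.
   Context: A graph is a set of vertices (of any cardinality) together with an irreflexive symmetric binary edge relation $\sim$. $\mathcal{L}_\sim$ is the first-order language (with equality) whose only non-logical symbol is the binary relation symbol $\sim$. $\Diamond\mathcal{L}_\sim$ is the closure of the set of $\mathcal{L}_\sim$-formulas under the modal operators $\Diamond,\Box$ and Boolean connectives, but not quantifiers; $\mathcal{L}_\sim^{\Diamond}$ is the full first-order modal language, closing $\mathcal{L}_\sim$ under modal operators, Boolean connectives and quantifiers. Formulas are evaluated at graphs, within the class of all graphs under the substructure relation: $G\models\Diamond\varphi[\bar a]$ iff there is a graph $H$ containing $G$ as a substructure (i.e. $G$ is an induced subgraph of $H$) with $H\models\varphi[\bar a]$; $G\models\Box\varphi[\bar a]$ iff $H\models\varphi[\bar a]$ for every graph $H$ containing $G$ as a substructure; Boolean connectives and quantifiers are interpreted as usual, with quantifiers ranging over the vertices of the graph at which the formula is evaluated. A vertex $x$ is connected to $y$ in $G$ if there is a finite path in $G$ from $x$ to $y$. *)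

(* Defs.v *)
From mathcomp Require Import all_boot.
From Stdlib Require List.

Set Implicit Arguments.
Unset Strict Implicit.
Unset Printing Implicit Defensive.

(* The vertex type may be empty or infinite, of any cardinality available in
   the ambient universe. *)
Record graph := Graph {
  vertex :> Type;
  adj : vertex -> vertex -> Prop;
  adj_irrefl : forall x, ~ adj x x;
  adj_sym : forall x y, adj x y -> adj y x
}.

(* "G is a substructure of H" is rendered by an embedding of G onto an induced
   subgraph of H; types have no literal inclusion. *)
Record embedding (G H : graph) := Embedding {
  emb :> G -> H;
  emb_inj : injective emb;
  emb_adj : forall x y, adj (emb x) (emb y) <-> adj x y
}.

(* [formula n] is the full first-order modal language of graph theory, with
   free variables among 0, ..., n-1.  A quantifier binds variable 0 of its body
   and shifts the other variables by one. *)
Inductive formula : nat -> Type :=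
| FEq n (i j : 'I_n) : formula n
| FAdj n (i j : 'I_n) : formula n
| FNot n (phi : formula n) : formula n
| FAnd n (phi psi : formula n) : formula n
| FOr n (phi psi : formula n) : formula n
| FImp n (phi psi : formula n) : formula n
| FForall n (phi : formula n.+1) : formula n
| FExists n (phi : formula n.+1) : formula n
| FDiamond n (phi : formula n) : formula n
| FBox n (phi : formula n) : formula n.

Definition sentence := formula 0.

Fixpoint first_order n (phi : formula n) : bool :=
  match phi with
  | FEq _ _ _ | FAdj _ _ _ => true
  | FNot _ p => first_order p
  | FAnd _ p q | FOr _ p q | FImp _ p q => first_order p && first_order q
  | FForall _ p | FExists _ p => first_order p
  | FDiamond _ _ | FBox _ _ => false
  end.

(* Closure of the first-order formulas under modalities and Boolean
   connectives: no quantifier is applied to a formula with a modality. *)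
Inductive diamond_lang n : formula n -> Prop :=
| DL_first_order phi : first_order phi -> diamond_lang phi
| DL_not phi : diamond_lang phi -> diamond_lang (FNot phi)
| DL_and phi psi :
    diamond_lang phi -> diamond_lang psi -> diamond_lang (FAnd phi psi)
| DL_or phi psi :
    diamond_lang phi -> diamond_lang psi -> diamond_lang (FOr phi psi)
| DL_imp phi psi :
    diamond_lang phi -> diamond_lang psi -> diamond_lang (FImp phi psi)
| DL_diamond phi : diamond_lang phi -> diamond_lang (FDiamond phi)
| DL_box phi : diamond_lang phi -> diamond_lang (FBox phi).

(* The i-th entry of the tuple [a] is the value of variable i; at a modality
   the values are carried along the embedding. *)
Fixpoint sat n (phi : formula n) : forall G : graph, n.-tuple G -> Prop :=
  match phi in formula n return forall G : graph, n.-tuple G -> Prop with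
  | FEq _ i j => fun G a => tnth a i = tnth a j
  | FAdj _ i j => fun G a => adj (tnth a i) (tnth a j)
  | FNot _ p => fun G a => ~ sat p a
  | FAnd _ p q => fun G a => sat p a /\ sat q a
  | FOr _ p q => fun G a => sat p a \/ sat q a
  | FImp _ p q => fun G a => sat p a -> sat q a
  | FForall _ p => fun G a => forall v : G, sat p (cons_tuple v a)
  | FExists _ p => fun G a => exists v : G, sat p (cons_tuple v a)
  | FDiamond _ p => fun G a =>
      exists (H : graph) (f : embedding G H), sat p (map_tuple f a)
  | FBox _ p => fun G a =>
      forall (H : graph) (f : embedding G H), sat p (map_tuple f a)
  end.

Definition holds (sigma : sentence) (G : graph) : Prop :=
  @sat 0 sigma G [tuple].

Fixpoint adj_chain (G : graph) (x : G) (p : seq G) : Prop :=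
  if p is z :: q then adj x z /\ adj_chain z q else True.

(* The vertices x :: p, in order, form a path from x to y, without repetition;
   for p = [::] it is the path of length 0 from x to itself. *)
Definition is_path (G : graph) (x : G) (p : seq G) (y : G) : Prop :=
  [/\ adj_chain x p, last x p = y & List.NoDup (x :: p)].

Definition connected_to (G : graph) (x y : G) : Prop :=
  exists p : seq G, is_path x p y.

Definition connected_graph (G : graph) : Prop :=
  forall x y : G, connected_to x y.

(* Main.v *)
Require Import Defs.
From mathcomp Require Import all_boot.
From Stdlib Require List.
From Stdlib Require Import Classical.

(** A vertex [c] is saturated when every neighbour of a neighbour of [c] is [c]
    itself or a neighbour of [c].  A walk that starts next to a saturated [c]
    never leaves the closed neighbourhood of [c], whether or not it visits [c].
    Hence, if [x] is connected to [y] in [G], then in every extension of [G] a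
    saturated neighbour of [x] equals or is adjacent to [y].  Conversely, adding
    to [G] one vertex joined to exactly the component of [x] gives a saturated
    neighbour of [x] that is adjacent to [y] only if [y] is in that component.
    So connectivity of [x] and [y] is expressed by "necessarily, every saturated
    neighbour of [x] equals or is adjacent to [y]". *)

Set Implicit Arguments.
Unset Strict Implicit.
Unset Printing Implicit Defensive.

Lemma adj_chain_cat (G : graph) (x : G) (p q : seq G) :
  adj_chain x (p ++ q) <-> adj_chain x p /\ adj_chain (last x p) q.
Proof.
elim: p x => [|z p IHp] x /=; first by split=> [|[]].
by rewrite IHp; split=> [[? []]|[[? ?] ?]].
Qed.

Lemma In_prefix (T : Type) (v x : T) (p : seq T) :
  List.In v (x :: p) -> exists p1 p2, p = p1 ++ p2 /\ last x p1 = v.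
Proof.
elim: p x => [|z p IHp] x /=.
  by case=> [<-|[]]; exists [::], [::].
case=> [<-|/IHp [p1 [p2 [-> <-]]]]; first by exists [::], (z :: p).
by exists (z :: p1), p2.
Qed.

Lemma connected_to_refl (G : graph) (x : G) : connected_to x x.
Proof.
by exists [::]; split=> //; apply: List.NoDup_cons (List.NoDup_nil _) => -[].
Qed.

Lemma connected_to_adj (G : graph) (x u v : G) :
  connected_to x u -> adj u v -> connected_to x v.
Proof.
move=> [p [chain_p last_p uniq_p]] adj_uv.
(* A path has no repetition: if [v] already lies on it, it is cut at [v]; otherwise [v] is
   appended. *)
have [v_p|v_notin_p] := classic (List.In v (x :: p)).
- have [p1 [p2 [def_p last_p1]]] := In_prefix v_p.
  exists p1; split=> //.
    by move: chain_p; rewrite def_p => /adj_chain_cat [].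
  by apply: (@List.NoDup_app_remove_r _ _ p2); move: uniq_p; rewrite def_p.
exists (p ++ [:: v]); split; last 1 first.
- apply: (@List.NoDup_app _ (x :: p) [:: v]) => //.
    by apply: List.NoDup_cons (List.NoDup_nil _) => -[].
  by move=> w w_p [def_w|[]]; rewrite -def_w in w_p.
- by apply/adj_chain_cat; rewrite last_p.
by rewrite last_cat.
Qed.

Section ComponentApex.

Variables (G : graph) (x : G).

Definition apex_adj (u v : option G) : Prop :=
  match u, v with
  | Some u, Some v => adj u v
  | Some w, None | None, Some w => connected_to x w
  | None, None => False
  end.

Lemma apex_adj_irrefl u : ~ apex_adj u u.
Proof. by case: u => [u /adj_irrefl|]. Qed.

Lemma apex_adj_sym u v : apex_adj u v -> apex_adj v u.
Proof. by case: u v => [u|] [v|] //= /adj_sym. Qed.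

Definition component_apex : graph := Graph apex_adj_irrefl apex_adj_sym.

Definition apex_embedding : embedding G component_apex :=
  @Embedding G component_apex Some Some_inj (fun _ _ => iff_refl _).

End ComponentApex.

Definition saturated (G : graph) (c : G) : Prop :=
  forall u v : G, adj u c /\ adj u v -> v = c \/ adj v c.

Lemma saturated_apex (G : graph) (x : G) :
  @saturated (component_apex x) None.
Proof.
move=> [u|] [v|] /= [xu uv] //; [right | by left].
exact: connected_to_adj xu uv.
Qed.

Lemma saturated_walk (G H : graph) (f : embedding G H) (c : H) (x : G) p :
  saturated c -> adj_chain x p ->
  f x = c \/ adj (f x) c -> f (last x p) = c \/ adj (f (last x p)) c.
Proof.
move=> sat_c; elim: p x => //= z p IHp x [xz chain_p] near_x.
move/emb_adj: xz => /(_ _ f) xz; apply: IHp chain_p _.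
case: near_x => [<-|xc]; first by right; apply: adj_sym.
exact: (sat_c (f x)).
Qed.

Lemma connected_to_saturated (G : graph) (x y : G) :
  connected_to x y <->
  forall (H : graph) (f : embedding G H) (c : H),
    adj (f x) c /\ saturated c -> f y = c \/ adj (f y) c.
Proof.
split=> [[p [chain_p <- _]] H f c [xc sat_c] | near_y].
  by apply: saturated_walk => //; right.
(* This is the conclusion of [near_y] for the apex [None]. *)
suff: Some y = None \/ connected_to x y by case.
apply: (near_y _ (apex_embedding x) None).
by split; [exact: connected_to_refl | exact: saturated_apex].
Qed.

Definition var n i (lt_in : i < n) : 'I_n := Ordinal lt_in.

(* In the scope of the first quantifier, variable 0 is the vertex c and the
   variables 1 and 2 are x and y; two quantifiers further, variables 0, 1 and 2
   are v, u and c. *)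
Definition saturated_fml : formula 3 :=
  FForall (FForall
    (FImp (FAnd (FAdj (@var 5 1 isT) (@var 5 2 isT))
                (FAdj (@var 5 1 isT) (@var 5 0 isT)))
          (FOr (FEq (@var 5 0 isT) (@var 5 2 isT))
               (FAdj (@var 5 0 isT) (@var 5 2 isT))))).

Definition connected_fml : formula 2 :=
  FBox (FForall
    (FImp (FAnd (FAdj (@var 3 1 isT) (@var 3 0 isT)) saturated_fml)
          (FOr (FEq (@var 3 2 isT) (@var 3 0 isT))
               (FAdj (@var 3 2 isT) (@var 3 0 isT))))).

Lemma diamond_lang_connected_fml : diamond_lang connected_fml.
Proof. exact/DL_box/DL_first_order. Qed.

(** The formula evaluates by conversion to the right-hand side of [connected_to_saturated]. *)
Lemma sat_connected_fml (G : graph) (x y : G) :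
  sat connected_fml [tuple x; y] <-> connected_to x y.
Proof. by rewrite connected_to_saturated. Qed.

Theorem theorem2 :
  (exists chi : formula 2,
     diamond_lang chi /\
     forall (G : graph) (x y : G),
       sat chi [tuple x; y] <-> connected_to x y) /\
  (exists sigma : sentence,
     forall G : graph, holds sigma G <-> connected_graph G).
Proof.
split.
  exists connected_fml; split; first exact: diamond_lang_connected_fml.
  exact: sat_connected_fml.
exists (FForall (FForall connected_fml)) => G.
(* The inner quantifier gives variable 0, so the pair is swapped; both being universal, this is
   harmless. *)
by split=> conn x y; apply/sat_connected_fml; apply: conn.
Qed.
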